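(* Let $\Delta$ be a smooth reflexive polytope of dimension $n\ge3$ with $|V|$ vertices. Then the following bounds hold for the line Chern numbers of any pair of distinct adjacent edges $e,f$ of $\Delta$: $$(3-n)\,|V|\cdot\frac{n(n+1)^2}{2}-2\le c_e(f)<|V|\cdot\frac{n(n+1)^2}{2}.$$
   Context: A lattice polytope $\Delta\subset\mathbb{R}^n$ of dimension $n$ (vertices in $\mathbb{Z}^n$) is smooth if at every vertex there are exactly $n$ edges and the primitive integer vectors along these edges form a $\mathbb{Z}$-basis of $\mathbb{Z}^n$. It is reflexive if the origin lies in its interior and its dual polytope is also a lattice polytope. Line Chern numbers of a smooth polytope $\Delta$: for an edge $e$ directed from vertex $p$ to vertex $q$ let $\alpha(e)\in\mathbb{Z}^n$ be the primitive vector in the direction of $e$ (from $p$ to $q$). For distinct edges $e,f$ starting at the vertex $p$, with $e$ joining $p$ to $q$, let $\mathcal{F}$ be the 2-dimensional face containing $e$ and $f$, and let $\nabla_e(f)$ be the unique other edge of $\mathcal{F}$ at $q$, directed away from $q$. Then $\alpha(f)-\alpha(\nabla_e(f))=c_e(f)\,\alpha(e)$ for a unique integer $c_e(f)$, called a line Chern number of $\Delta$. Distinct adjacent edges are edges $e\ne f$ with the same initial vertex. *)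

(* Defs.v *)
From HB Require Import structures.
From mathcomp Require Import all_boot all_order all_algebra finmap.
From mathcomp Require Import boolp classical_sets functions cardinality.
From mathcomp Require Import reals topology normedtype.

Set Implicit Arguments.
Unset Strict Implicit.
Unset Printing Implicit Defensive.

Import Order.TTheory GRing.Theory Num.Theory.
Import numFieldNormedType.Exports.
Local Open Scope classical_set_scope.
Local Open Scope ring_scope.

Section Polytopes.
Variables (R : realType) (n : nat).
Implicit Types (A F D : set 'rV[R]_n) (x y : 'rV[R]_n).

Definition dot x y : R := \sum_i x 0 i * y 0 i.

Definition hull (s : seq 'rV[R]_n) : set 'rV[R]_n :=
  [set x | exists w : 'I_(size s) -> R,
    [/\ forall i, 0 <= w i, \sum_i w i = 1 & x = \sum_i w i *: s`_i]].

Definition segment x y : set 'rV[R]_n := hull [:: x; y].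

Definition is_polytope D := exists s : seq 'rV[R]_n, D = hull s.

(* The affine hull of A has dimension d: the d+1 points x0 and x0 + row i U
   of A are affinely independent and their affine hull contains A. *)
Definition has_dim A (d : nat) :=
  exists (x0 : 'rV[R]_n) (U : 'M[R]_(d, n)),
    [/\ row_free U, A x0, forall i, A (x0 + row i U)
      & forall y, A y -> (y - x0 <= U)%MS].

(* Intersections with supporting hyperplanes; a = 0 gives D itself and the
   empty face. *)
Definition is_face D F :=
  exists (a : 'rV[R]_n) (b : R),
    (forall x, D x -> dot a x <= b) /\ F = [set x | D x /\ dot a x = b].

Definition vertices D : set 'rV[R]_n := [set x | is_face D [set x]].

Definition num_vertices D : nat := #|` fset_set (vertices D)|%fset.

Definition zvec (v : 'rV[int]_n) : 'rV[R]_n := map_mx intr v.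

Definition is_lattice_polytope D :=
  is_polytope D /\
  forall x, vertices D x -> exists v : 'rV[int]_n, x = zvec v.

Definition dual_polytope D : set 'rV[R]_n :=
  [set y | forall x, D x -> dot x y <= 1].

Definition is_reflexive D :=
  [/\ is_lattice_polytope D, interior D 0
    & is_lattice_polytope (dual_polytope D)].

(* The directed edge of D from p to q. Its endpoints are vertices of D, so no
   edge of a lattice polytope is lost by taking them in Z^n. *)
Definition is_edge D (p q : 'rV[int]_n) :=
  p <> q /\ is_face D (segment (zvec p) (zvec q)).

Definition content (v : 'rV[int]_n) : nat := \big[gcdn/0%N]_i absz (v 0 i).

(* The primitive integer vector alpha(e) of the directed edge e from p to q. *)
Definition edge_dir (p q : 'rV[int]_n) : 'rV[int]_n :=
  \row_i divz ((q - p) 0 i) (content (q - p))%:Z.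

Definition is_Zbasis (b : 'I_n -> 'rV[int]_n) :=
  forall v : 'rV[int]_n, exists! c : 'rV[int]_n, v = \sum_i c 0 i *: b i.

Definition is_smooth D :=
  [/\ is_lattice_polytope D, has_dim D n
    & forall p : 'rV[int]_n, vertices D (zvec p) ->
        exists q : 'I_n -> 'rV[int]_n,
          [/\ injective q, forall r, is_edge D p r <-> exists i, r = q i
            & is_Zbasis (fun i => edge_dir p (q i))]].

(* c = c_e(f) for the distinct edges e, f of D from p to q and from p to r;
   the edge nabla_e(f) goes from q to s. *)
Definition is_line_chern D (p q r : 'rV[int]_n) (c : int) :=
  exists (F : set 'rV[R]_n) (s : 'rV[int]_n),
    [/\ is_face D F /\ has_dim F 2,
        segment (zvec p) (zvec q) `<=` F /\ segment (zvec p) (zvec r) `<=` F,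
        is_edge D q s /\ segment (zvec q) (zvec s) `<=` F,
        s <> p
      & edge_dir p r - edge_dir q s = c *: edge_dir p q].

End Polytopes.

(* Main.v *)
Require Import Defs.
From mathcomp Require Import all_boot all_order all_algebra finmap.
From mathcomp Require Import ring lra zify.
From mathcomp Require Import boolp classical_sets cardinality.
From mathcomp Require Import reals topology normedtype.

Set Implicit Arguments.
Unset Strict Implicit.
Unset Printing Implicit Defensive.

(** Let [l(e)] be the lattice length of the edge [e]. Reflexivity makes each
    vertex minus the sum of its primitive edge vectors, so that
    [l(e) = 2 + sum_f c_e(f)]; convexity gives [c_e(f) <= l(e)]. Hence it
    suffices to bound [l(e)]. Whenever [c_e(f) >= 2], the 2-face of [e] and [f]
    has a second edge [e'] parallel to [e], with Chern number at most
    [- c_e(f)]. In the sum of [l] over all edges of a fixed direction, the Chern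
    numbers [>= 2] are thus cancelled, and what remains is at most
    [(n + 1) |V|]. This bounds [l(e)], and solving for one [c_e(f)] in
    [l(e) = 2 + sum_f c_e(f)], with one of the other terms at most [l(e)] and
    the remaining [n - 3] at most [(n + 1) |V|], gives the lower bound. *)

Import Order.TTheory GRing.Theory Num.Theory.
Import numFieldNormedType.Exports.
Local Open Scope ring_scope.

(** * Line Chern numbers of unimodular vertex-edge data *)

(** Each term [>= 2] is cancelled by its own image under [phi], which is [<= -2]; the terms in
    between count at most 1 each. *)
Lemma sum_le_card_of_cancelling (X : finType) (P : pred X) (c : X -> int)
    (phi : X -> X) :
  (forall x, P x -> 2 <= c x -> P (phi x) /\ c (phi x) <= - c x) ->
  (forall x y, P x -> 2 <= c x -> P y -> 2 <= c y -> phi x = phi y -> x = y) ->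
  \sum_(x | P x) c x <= #|P|%:Z.
Proof.
move=> hphi hinj.
pose Q := [pred x | P x && (2 <= c x)].
have split3 : \sum_(x | P x) c x <= #|P|%:Z + \sum_(x | Q x) c x
    + \sum_(x | P x && (c x <= -2)) c x.
  have -> : #|P|%:Z = \sum_(x | P x) 1 by rewrite sumr_const natz.
  rewrite /Q /= !big_mkcondr -!big_split /=.
  by apply: ler_sum => x _; case: ifP; case: ifP; lia.
apply: le_trans split3 _.
have img : \sum_(x | P x && (c x <= -2)) c x
    <= \sum_(x in [set phi x | x in Q]) c x.
  rewrite (bigID (mem [set phi x | x in Q])) /=.
  rewrite -[leRHS]addr0; apply: lerD; last first.
    by apply: sumr_le0 => x /andP[/andP[_ ?] _]; lia.
  rewrite le_eqVlt; apply/orP; left; apply/eqP; apply: eq_bigl => x.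
  case: imsetP => [[y /andP[Py cy] ->]|]; last by rewrite andbF.
  have [-> cphi] := hphi y Py cy; rewrite andbT /=; lia.
have : \sum_(x | P x && (c x <= -2)) c x <= - \sum_(x | Q x) c x.
  apply: le_trans img _; rewrite -sumrN big_imset; last first.
    by move=> x y /andP[Px cx] /andP[Py cy]; exact: hinj.
  by apply: ler_sum => x /andP[Px cx]; case: (hphi x Px cx).
lia.
Qed.

Section SmoothReflexive.
(** [T] indexes the vertices; row [i] of [A v] is the primitive vector of the [i]-th edge at [v],
    [nb v i] its far end, and [bk v i] the index of the same edge there. [coord_ge0] puts all
    vertices in the tangent cone at each vertex. *)
Variables (n : nat) (T : finType) (pos : T -> 'rV[int]_n) (A : T -> 'M[int]_n).
Variables (nb : T -> 'I_n -> T) (bk : T -> 'I_n -> 'I_n).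
Variable len : T -> 'I_n -> int.
Hypothesis pos_inj : injective pos.
Hypothesis A_unit : forall v, A v \in unitmx.
Hypothesis coord_ge0 : forall v w i, 0 <= ((pos w - pos v) *m invmx (A v)) 0 i.
Hypothesis len_gt0 : forall v i, 0 < len v i.
Hypothesis pos_nb : forall v i, pos (nb v i) = pos v + len v i *: row i (A v).
Hypothesis row_bk : forall v i, row (bk v i) (A (nb v i)) = - row i (A v).
Hypothesis pos_sum : forall v, pos v = - \sum_i row i (A v).

Local Notation al v i := (row i (A v)).
Local Notation co v x := (x *m invmx (A v)).

Lemma co_row v i : co v (al v i) = delta_mx 0 i.
Proof. by rewrite -row_mul mulmxV ?A_unit // row1. Qed.

Lemma co_rowE v i j : co v (al v i) 0 j = (j == i)%:R.
Proof. by rewrite co_row mxE eqxx. Qed.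

Lemma co_expand v x : x = \sum_i co v x 0 i *: al v i.
Proof.
by rewrite -{1}[x](mulmxKV (A_unit v)) {1}mulmx_sum_row.
Qed.

Lemma row_A_inj v : injective (fun i => al v i).
Proof.
move=> i j /(congr1 (fun x => co v x 0 i)); rewrite /= !co_rowE eqxx.
by case: eqP.
Qed.

(** If [w] lies on the [k]-th facet hyperplane at [v], an edge from [w] cannot cross it, as its far
    end is in the cone at [v] too. *)
Lemma co_edge_ge0 v w m k :
  co v (pos w - pos v) 0 k = 0 -> 0 <= co v (al w m) 0 k.
Proof.
move=> h; rewrite -(pmulr_rge0 _ (len_gt0 w m)).
have := coord_ge0 v (nb w m) k.
by rewrite pos_nb addrAC mulmxDl -scalemxAl mxE h add0r mxE.
Qed.

(** Coordinates at the far end, where the edge itself is minus the basis vector [bk v i], replace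
    the 2-face of the usual definition. *)
Definition chern v i j : int := - co (nb v i) (al v j) 0 (bk v i).

(** The base changes between [v] and [nb v i] are mutually inverse and, away from the common edge,
    have nonnegative integer entries; there they can only permute the basis. *)
Lemma chern_transition v i j : j != i ->
  exists2 j', j' != bk v i & al (nb v i) j' = al v j - chern v i j *: al v i.
Proof.
move=> ji; set w := nb v i; set i' := bk v i.
have coi' : co v (al w i') = - delta_mx 0 i by rewrite row_bk mulNmx co_row.
have S0 m k : k != i -> 0 <= co v (al w m) 0 k.
  move=> ki; apply: co_edge_ge0.
  by rewrite pos_nb addrC addKr -scalemxAl mxE co_rowE (negPf ki) mulr0.
have T0 m k : k != i' -> 0 <= co w (al v m) 0 k.
  move=> ki; apply: co_edge_ge0.
  rewrite pos_nb opprD addNKr -[al v i]opprK -row_bk scalerN opprK.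
  by rewrite -scalemxAl mxE co_rowE (negPf ki) mulr0.
have TS k : \sum_m co w (al v j) 0 m * co v (al w m) 0 k = (k == j)%:R.
  rewrite -(co_rowE v) {2}(co_expand w (al v j)) mulmx_suml summxE.
  by apply: eq_bigr => m _; rewrite -scalemxAl [in RHS]mxE.
have TSge0 k m : k != i -> 0 <= co w (al v j) 0 m * co v (al w m) 0 k.
  move=> ki; have [->|mi] := eqVneq m i'; last by apply: mulr_ge0; auto.
  by rewrite coi' !mxE eqxx (negPf ki) oppr0 mulr0.
have [j' TSj'] : exists m, co w (al v j) 0 m * co v (al w m) 0 j != 0.
  apply/existsP; rewrite -[X in is_true X]negbK negb_exists.
  apply/negP => /forallP TS0; have := TS j; rewrite eqxx big1 //.
  by move=> m _; apply/eqP; have := TS0 m; rewrite negbK.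
have j'i' : j' != i'.
  apply: contraNneq TSj' => ->.
  by rewrite coi' !mxE eqxx (negPf ji) oppr0 mulr0.
have T_gt0 : 0 < co w (al v j) 0 j'.
  by rewrite lt_def T0 // andbT; apply: contraNneq TSj' => ->; rewrite mul0r.
have S_gt0 : 0 < co v (al w j') 0 j.
  by rewrite lt_def S0 // andbT; apply: contraNneq TSj' => ->; rewrite mulr0.
have Sj0 k : k != i -> k != j -> co v (al w j') 0 k = 0.
  move=> ki kj; have := TS k; rewrite (negPf kj).
  move/(psumr_eq0P (fun m _ => TSge0 k m ki))/(_ j' isT)/eqP.
  by rewrite mulf_eq0 gt_eqF //= => /eqP.
(* Two positive integers whose product is one term of a nonnegative sum equal to 1. *)
have Sj1 : co v (al w j') 0 j = 1.
  have := TS j; rewrite eqxx (bigD1 j') //=.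
  have : 0 <= \sum_(m | m != j') co w (al v j) 0 m * co v (al w m) 0 j.
    by apply: sumr_ge0 => m _; apply: TSge0.
  move: T_gt0 S_gt0 => /=; move: (co w _ 0 _) (co v _ 0 _) (\sum_(m | _) _).
  by move=> t s z; nia.
have alE : al w j' = al v j + co v (al w j') 0 i *: al v i.
  rewrite {1}(co_expand v (al w j')) (bigD1 j) //= Sj1 scale1r; congr (_ + _).
  rewrite (bigD1 i) ?(eq_sym i) //= big1 ?addr0 // => k /andP[kj ki].
  by rewrite Sj0 // scale0r.
exists j' => //; rewrite alE; congr (_ + _); rewrite -scaleNr; congr (_ *: _).
rewrite /chern opprK.
have -> : al v j = al w j' + co v (al w j') 0 i *: al w i'.
  by rewrite {1}alE row_bk scalerN addrK.
rewrite mulmxDl -scalemxAl !co_row [in RHS]mxE [X in X + _]mxE [X in _ + X]mxE.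
by rewrite [delta_mx _ _ _ _ in RHS]mxE !eqxx eq_sym (negPf j'i') add0r mulr1.
Qed.

(** The index [j'] cannot be the reversed edge, since [al v j] is no multiple of [al v i]; so [c]
    can be read off in the basis at the far end. *)
Lemma chern_unique v i j j' c : j != i ->
  al (nb v i) j' = al v j - c *: al v i -> c = chern v i j.
Proof.
move=> ji h; set w := nb v i.
have aE : al v j = al w j' - c *: al w (bk v i).
  by rewrite /w h row_bk scalerN opprK subrK.
have j'b : j' != bk v i.
  apply: contraNneq ji => j'b; move: h; rewrite j'b row_bk.
  move/(congr1 (fun x => co v x 0 j)).
  rewrite mulmxBl mulNmx -scalemxAl !co_row.
  by rewrite !mxE !eqxx; case: (j == i) => //; lia.
rewrite /chern -/w aE mulmxBl -scalemxAl !co_row !mxE !eqxx eq_sym (negPf j'b).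
by rewrite mulr1 add0r opprK.
Qed.

(** By [pos_sum] every vertex has all coordinates -1 in its own basis. Computing the coordinate of
    [pos v - pos w] along the reversed edge in two ways gives the formula. *)
Lemma len_sum_chern v i : len v i = 2 + \sum_(j | j != i) chern v i j.
Proof.
set w := nb v i; set i' := bk v i.
have co_pos u k : co u (pos u) 0 k = -1.
  rewrite pos_sum mulNmx mxE mulmx_suml summxE (bigD1 k) //= co_rowE eqxx.
  by rewrite big1 ?addr0 // => m mk; rewrite co_rowE eq_sym (negPf mk).
have : co w (pos v - pos w) 0 i' = len v i.
  rewrite pos_nb opprD addNKr -[al v i]opprK -row_bk scalerN opprK.
  by rewrite -scalemxAl mxE co_rowE eqxx mulr1.
rewrite mulmxBl mxE [X in _ + X]mxE co_pos opprK => <-.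
rewrite pos_sum mulNmx mxE mulmx_suml summxE (bigD1 i) //=.
rewrite -[al v i]opprK -row_bk mulNmx [X in - (X + _)]mxE co_rowE eqxx.
rewrite opprD opprK addrAC; congr (_ + _); rewrite -sumrN.
by apply: eq_bigr.
Qed.

(** The neighbour [nb v j] lies in the cone at [nb v i], which gives
    [len v j * chern v i j <= len v i]. *)
Lemma chern_le_len v i j : chern v i j <= len v i.
Proof.
set w := nb v i; set i' := bk v i.
have := coord_ge0 w (nb v j) i'.
have -> : pos (nb v j) - pos w = len v j *: al v j + len v i *: al w i'.
  by rewrite !pos_nb row_bk; apply/rowP => k; rewrite !mxE; ring.
rewrite mulmxDl -!scalemxAl mxE [X in _ + X]mxE co_rowE eqxx mulr1 mxE.
have := len_gt0 v j; have := len_gt0 v i; rewrite /chern -/w -/i'.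
set t := (_ *m _) 0 i'; nia.
Qed.

(* The edges [g], [h] at [u] are [x1 a + y1 b], [x2 a + y2 b], and they span the
   same rank-2 lattice as [a], [b]. *)
Definition flag (a b : 'rV[int]_n) u g h (x1 y1 x2 y2 : int) :=
  [/\ g != h, al u g = x1 *: a + y1 *: b, al u h = x2 *: a + y2 *: b
    & (x1 * y2 - x2 * y1) ^+ 2 = 1].

Lemma flag_swap a b u g h x1 y1 x2 y2 :
  flag a b u g h x1 y1 x2 y2 -> flag a b u h g x2 y2 x1 y1.
Proof. by case=> gh ug uh d; split; rewrite // 1?eq_sym // -d; ring. Qed.

(** Cramer's rule; multiplying by the determinant replaces dividing by it, as its square is 1. *)
Lemma flag_cone a b u g h x1 y1 x2 y2 w P Q :
  flag a b u g h x1 y1 x2 y2 -> pos w - pos u = P *: a + Q *: b ->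
  0 <= (x1 * y2 - x2 * y1) * (P * y2 - Q * x2) /\
  0 <= (x1 * y2 - x2 * y1) * (Q * x1 - P * y1).
Proof.
case=> gh ug uh; set d := x1 * y2 - x2 * y1 => d1 wu.
have wE : pos w - pos u =
    (d * (P * y2 - Q * x2)) *: al u g + (d * (Q * x1 - P * y1)) *: al u h.
  rewrite wu -[P *: a]scale1r -[Q *: b]scale1r -d1 ug uh.
  by apply/rowP => k; rewrite !mxE /d; ring.
have := coord_ge0 u w g; have := coord_ge0 u w h.
rewrite wE mulmxDl -!scalemxAl !co_row !mxE !eqxx (negPf gh) eq_sym (negPf gh).
by rewrite !mulr1 !mulr0 addr0 add0r.
Qed.

(** Walks along one side of the polygon. The determinant changes sign, so a flag fixes only its
    square. *)
Lemma flag_step a b u g h x1 y1 x2 y2 :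
  flag a b u g h x1 y1 x2 y2 ->
  exists h', flag a b (nb u g) (bk u g) h' (- x1) (- y1)
    (x2 - chern u g h * x1) (y2 - chern u g h * y1).
Proof.
case=> gh ug uh d1; rewrite eq_sym in gh.
have [h' h'b h'E] := chern_transition u gh.
exists h'; split; first by rewrite eq_sym.
- by rewrite row_bk ug; apply/rowP => k; rewrite !mxE; ring.
- by rewrite h'E ug uh; apply/rowP => k; rewrite !mxE; ring.
- by rewrite -d1; ring.
Qed.

(* With [c_e >= 2] the polygon narrows too fast away from [e] to end in a vertex
   with two non-horizontal lattice edges of determinant 1, so it ends in an edge
   parallel to [e]; comparing widths bounds its Chern number. *)
Lemma opposite_edge v i j : j != i -> 2 <= chern v i j ->
  exists v' i' j', [/\ j' != i', al v' i' = al v i,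
    exists b, al v' j' = b *: al v i - al v j,
    exists X Y, pos v' - pos v = X *: al v i + Y *: al v j
    & chern v' i' j' <= - chern v i j].
Proof.
move=> ji c2; set a := al v i; set b := al v j; set c := chern v i j in c2 *.
have flag0 : flag a b v i j 1 0 0 1.
  by split; rewrite 1?eq_sym // ?scale1r ?scale0r ?addr0 ?add0r.
pose q := nb v i; set l := len v i.
have l0 : 0 < l := len_gt0 v i.
have [f' flagq] : exists f', flag a b q (bk v i) f' (-1) 0 (- c) 1.
  have [f'] := flag_step flag0.
  by rewrite -/c mulr0 mulr1 oppr0 subr0 sub0r; exists f'.
have posq : pos q = pos v + l *: a by rewrite pos_nb.
pose inF u X Y := pos u = pos v + (X *: a + Y *: b).
have coX u X Y : inF u X Y -> 0 <= X /\ 0 <= Y.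
  move=> uE; have : pos u - pos v = X *: a + Y *: b by rewrite uE addrC addKr.
  by move/(flag_cone flag0); lia.
(* The side at [q] leans inwards by [c] per unit of height. *)
have coq u X Y : inF u X Y -> X + c * Y <= l.
  move=> uE; have : pos u - pos q = (X - l) *: a + Y *: b.
    by rewrite uE posq; apply/rowP => k; rewrite !mxE; ring.
  by move/(flag_cone flagq); lia.
(* This stands in for the 2-face: vertices in the plane through [v] spanned by [a], [b] that carry a
   flag. The vertex [u] below has maximal [b]-coordinate among them. *)
pose isF u := exists g h x1 y1 x2 y2 X Y,
  flag a b u g h x1 y1 x2 y2 /\ inF u X Y.
pose ht u := co v (pos u - pos v) 0 j.
have htE u X Y : inF u X Y -> ht u = Y.
  move=> uE; rewrite /ht uE [pos v + _]addrC addrK mulmxDl -!scalemxAl.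
  by rewrite !co_row !mxE !eqxx (negPf ji) mulr0 mulr1 add0r.
have [u [g [h [x1 [y1 [x2 [y2 [X [Y [fu uE]]]]]]]]] umax] :
    exists2 u, isF u & forall w, isF w -> ht w <= ht u.
  have P0 : `[< isF v >].
    apply/asboolP; exists i, j, 1, 0, 0, 1, 0, 0; split=> //.
    by rewrite /inF !scale0r !addr0.
  case: (@arg_maxP _ _ _ v (fun u => `[< isF u >]) ht P0) => u /asboolP hu umax.
  exists u => // w hw.
  by apply: umax; apply/asboolP.
rewrite (htE _ _ _ uE) in umax.
have down g' h' x1' y1' x2' y2' : flag a b u g' h' x1' y1' x2' y2' -> y1' <= 0.
  move=> fu'; have [h'' fw] := flag_step fu'.
  have wE : inF (nb u g') (X + len u g' * x1') (Y + len u g' * y1').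
    case: fu' => _ ug _ _; rewrite /inF pos_nb uE ug.
    by apply/rowP => k; rewrite !mxE; ring.
  have := umax (nb u g'); rewrite (htE _ _ _ wE) => /(_ _).
  have hF : isF (nb u g') by do 8 eexists; split; [exact: fw | exact: wE].
  by move=> /(_ hF); have := len_gt0 u g'; nia.
have Y1 : 1 <= Y.
  have [h' fw] := flag_step (flag_swap flag0).
  have wE : inF (nb v j) 0 (len v j) by rewrite /inF pos_nb scale0r add0r.
  have hF : isF (nb v j) by do 8 eexists; split; [exact: fw | exact: wE].
  by have := umax _ hF; rewrite (htE _ _ _ wE); have := len_gt0 v j; lia.
have X0 := (coX _ _ _ uE).1; have lX := coq _ _ _ uE.
(* If both edges at [u] descended, the cone at [u] would have width [Y / (y1 * y2) <= Y] at height
   0, yet it contains the edge [e] of length [l >= 2 * Y]. *)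
have horizontal : y1 = 0 \/ y2 = 0.
  have y1le := down _ _ _ _ _ _ fu.
  have y2le := down _ _ _ _ _ _ (flag_swap fu).
  have pu : pos v - pos u = (- X) *: a + (- Y) *: b.
    by rewrite uE; apply/rowP => k; rewrite !mxE; ring.
  have qu : pos q - pos u = (l - X) *: a + (- Y) *: b.
    by rewrite uE posq; apply/rowP => k; rewrite !mxE; ring.
  have [P1 P2] := flag_cone fu pu.
  have [Q1 Q2] := flag_cone fu qu.
  have [y10|y1n] := eqVneq y1 0; first by left.
  have [y20|y2n] := eqVneq y2 0; first by right.
  exfalso; have l2Y : 2 * Y <= l by nia.
  have yy : 1 <= y1 * y2 by nia.
  case: fu => _ _ _ d1.
  have : x1 * y2 - x2 * y1 = 1 \/ x1 * y2 - x2 * y1 = -1 by nia.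
  by case=> d; rewrite d in P1 P2 Q1 Q2; nia.
have [g' [h' [x1' [x2' [y2' fu']]]]] :
    exists g' h' x1' x2' y2', flag a b u g' h' x1' 0 x2' y2'.
  case: horizontal => y0; first by exists g, h, x1, x2, y2; rewrite -y0.
  by exists h, g, x2, x1, y1; apply: flag_swap; rewrite -y0.
have [x1E y2'E] : (x1' = 1 \/ x1' = -1) /\ y2' = -1.
  have := down _ _ _ _ _ _ (flag_swap fu').
  case: fu' => _ _ _; rewrite mulr0 subr0 => xy y0.
  have : absz (x1' * y2') = 1%N by nia.
  by rewrite abszM => /eqP; rewrite muln_eq1 => /andP[/eqP ? /eqP ?]; lia.
(* Start the top edge at its left end, so that its direction is [a] and not [- a]. *)
have [p' [i' [j' [b' [X' [fp' pE']]]]]] :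
    exists p' i' j' b' X', flag a b p' i' j' 1 0 b' (-1) /\ inF p' X' Y.
  case: x1E => x1E.
    by exists u, g', h', x2', X; split=> //; move: fu'; rewrite x1E y2'E.
  have [h'' fw] := flag_step fu'.
  exists (nb u g'), (bk u g'), h'', (x2' + chern u g' h'), (X - len u g').
  split; first by move: fw; rewrite x1E y2'E mulr0 subr0 mulrN1 !opprK oppr0.
  case: fu' => _ ug _ _; rewrite /inF pos_nb uE ug x1E.
  by apply/rowP => k; rewrite !mxE; ring.
have [p'i p'j] : al p' i' = a /\ al p' j' = b' *: a - b.
  by case: fp' => _ -> -> _; rewrite scale1r scale0r addr0 scaleN1r.
exists p', i', j'; split=> //.
- by case: fp'; rewrite eq_sym.
- by exists b'.
- by exists X', Y; rewrite pE' addrC addKr.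
have [k fq'] := flag_step fp'.
set c' := chern p' i' j' in fq' *; pose q' := nb p' i'; pose l' := len p' i'.
have qE' : inF q' (X' + l') Y.
  by rewrite /inF /q' pos_nb pE' p'i; apply/rowP => m; rewrite !mxE; ring.
have pp : pos v - pos p' = (- X') *: a + (- Y) *: b.
  by rewrite pE'; apply/rowP => m; rewrite !mxE; ring.
have qq : pos q - pos q' = (l - X' - l') *: a + (- Y) *: b.
  by rewrite qE' posq; apply/rowP => m; rewrite !mxE; ring.
have [P1 _] := flag_cone fp' pp.
have [Q1 _] := flag_cone fq' qq.
have X'0 := (coX _ _ _ pE').1; have lX' := coq _ _ _ qE'.
(* The cones at [p'] and [q'] give [Y * c' <= l' - l], and the cone at [q] gives
   [l' - l <= - c * Y]. *)
have : Y * c' <= Y * - c by lia.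
by rewrite ler_pM2l //; lia.
Qed.

Lemma len_le (v0 : T) (i0 : 'I_n) : len v0 i0 <= (n.+1 * #|T|)%:Z.
Proof.
pose a := al v0 i0.
pose P := [pred x : T * 'I_n * 'I_n | (al x.1.1 x.1.2 == a) && (x.2 != x.1.2)].
pose c (x : T * 'I_n * 'I_n) := chern x.1.1 x.1.2 x.2.
have ex_phi (x : T * 'I_n * 'I_n) : exists y : T * 'I_n * 'I_n,
    P x -> 2 <= c x -> [/\ P y, exists b, al y.1.1 y.2 = b *: a - al x.1.1 x.2,
    exists X Y, pos y.1.1 - pos x.1.1 = X *: a + Y *: al x.1.1 x.2
    & c y <= - c x].
  case: (pselect (P x /\ 2 <= c x)) => [[/andP[/eqP xa ji] c2]|nP]; last first.
    by exists x => Px cx; case: nP.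
  have [v' [i' [j' [ji' ai' hb hX hc]]]] := opposite_edge ji c2.
  rewrite xa in ai' hb hX.
  exists (v', i', j') => _ _; split=> //.
  by apply/andP; split=> //; apply/eqP.
have [phi phiP] := choice ex_phi.
have sumP : \sum_(x | P x) c x <= #|P|%:Z.
  apply: (@sum_le_card_of_cancelling _ P c phi).
    by move=> x Px cx; have [] := phiP x Px cx.
  (* Injectivity: two edges with the same opposite edge and side direction lie in one plane, and
     each starting vertex lies in the cone at the other, which forces them to agree. *)
  move=> [[v i] j] [[w k] m] Px cx Py cy e.
  have [_ [b1 h1] [X1 [Y1 e1]] _] := phiP _ Px cx.
  have [_ [b2 h2] [X2 [Y2 e2]] _] := phiP _ Py cy.
  rewrite e in h1 e1; move: (phi _) h1 e1 h2 e2 => [[v' i'] j'] /= h1 e1 h2 e2.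
  move: Px Py => /andP[/= /eqP vi ji] /andP[/= /eqP wk mk].
  have bE : al w m = al v j + (b2 - b1) *: a.
    have : b1 *: a - al v j = b2 *: a - al w m by rewrite -h1 -h2.
    by move=> E; apply/rowP => t; move/rowP/(_ t): E; rewrite !mxE; lia.
  have fv : flag a (al v j) v i j 1 0 0 1.
    by split; rewrite 1?eq_sym // ?vi ?scale1r ?scale0r ?addr0 ?add0r.
  have fw : flag a (al v j) w k m 1 0 (b2 - b1) 1.
    split; rewrite 1?eq_sym // ?wk ?scale1r ?scale0r ?addr0 ?add0r //.
      by rewrite bE addrC.
    by rewrite mulr0 subr0 mul1r.
  have [X [Y wv]] : exists X Y, pos w - pos v = X *: a + Y *: al v j.
    exists (X1 - X2 - Y2 * (b2 - b1)), (Y1 - Y2).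
    have -> : pos w - pos v = (pos v' - pos v) - (pos v' - pos w).
      by apply/rowP => t; rewrite !mxE; ring.
    by rewrite e1 e2 bE; apply/rowP => t; rewrite !mxE; ring.
  have vw : pos v - pos w = (- X) *: a + (- Y) *: al v j.
    by rewrite -opprB wv; apply/rowP => t; rewrite !mxE; ring.
  have [c1 c2] := flag_cone fv wv.
  have [d1 d2] := flag_cone fw vw.
  have Y0 : Y = 0 by lia.
  have X0 : X = 0 by move: c1 d1; rewrite Y0; lia.
  have vwE : v = w.
    apply: pos_inj; apply/eqP; rewrite -subr_eq0 -oppr_eq0 opprB wv X0 Y0.
    by rewrite !scale0r addr0.
  subst w; have ik : i = k by apply: (@row_A_inj v); rewrite vi wk.
  subst k; congr (_, _); apply: (@row_A_inj v); rewrite bE.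
  have : (b2 - b1) = 0.
    move: bE => /(congr1 (fun x => co v x 0 i)).
    rewrite -vi mulmxDl -scalemxAl !co_row !mxE !eqxx.
    by rewrite ![i == _]eq_sym (negPf ji) (negPf mk); lia.
  by move=> ->; rewrite scale0r addr0.
pose N := #|[pred x : T * 'I_n | al x.1 x.2 == a]|.
(* At most one edge at each vertex has direction [a]. *)
have N_le : (N <= #|T|)%N.
  rewrite /N -(card_in_imset (f := fst)) ?max_card // => -[v i] [w k].
  move=> /eqP /= vi /eqP /= wk vw; subst w; congr (_, _).
  by apply: (@row_A_inj v); rewrite vi wk.
have sum_len : \sum_(x : T * 'I_n | al x.1 x.2 == a) len x.1 x.2
    = 2 * N%:Z + \sum_(x | P x) c x.
  under eq_bigr => x _ do rewrite len_sum_chern.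
  rewrite big_split /= pair_big_dep sumr_const -[2 *+ _]mulr_natr.
  by rewrite -[N%:Z]natz.
have cardP : #|P| = (N * n.-1)%N.
  rewrite -sum1_card -(pair_big_dep (fun x : T * 'I_n => al x.1 x.2 == a)
    (fun x j => j != x.2) (fun _ _ => 1%N)) /=.
  rewrite /N -sum_nat_const; apply: eq_bigr => x _.
  by rewrite sum1_card cardC1 card_ord.
have : len v0 i0 <= \sum_(x : T * 'I_n | al x.1 x.2 == a) len x.1 x.2.
  rewrite (bigD1 (v0, i0)) //= lerDl; apply: sumr_ge0 => x _.
  exact: ltW.
(* Total length is at most [2 * N + N * (n - 1)]; the index [i0] ensures that [n.-1] is not
   truncated. *)
have := ltn_ord i0; nia.
Qed.

Lemma chern_le v i j : chern v i j <= (n.+1 * #|T|)%:Z.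
Proof. exact: le_trans (chern_le_len v i j) (len_le v i). Qed.

Lemma chern_ge v i j : j != i -> (2 < n)%N ->
  - 2 - (n - 3)%:Z * (n.+1 * #|T|)%:Z <= chern v i j.
Proof.
move=> ji n3.
have cardi : #|predC1 i| = n.-1 by rewrite cardC1 card_ord.
have cardij : #|[predD1 predC1 i & j]| = (n - 2)%N.
  move: cardi; rewrite (cardD1 j) inE ji add1n => /(congr1 predn) /= ->; lia.
(* The term of [k] is bounded by [len v i], which cancels the left side of [len_sum_chern]; only
   [n - 3] terms then need [chern_le]. *)
have [k /andP[kj ki]] : exists k, k \in [predD1 predC1 i & j].
  by apply/card_gt0P; rewrite cardij; lia.
have cardijk : #|[pred m | [&& m != i, m != j & m != k]]| = (n - 3)%N.
  move: cardij; rewrite (cardD1 k) inE /= kj ki /= add1n.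
  move=> /(congr1 predn) /= e.
  rewrite (_ : (n - 3 = (n - 2).-1)%N) -?e; last lia.
  by apply: eq_card => m; rewrite !inE andbC -andbA andbCA.
have := len_sum_chern v i; rewrite (bigD1 j) //= (bigD1 k) /=; last exact/andP.
have := chern_le_len v i k.
pose s : int := \sum_(m | [&& m != i, m != j & m != k]) chern v i m.
have : s <= (n - 3)%:Z * (n.+1 * #|T|)%:Z.
  rewrite -[X in X * _]natz mulr_natl -cardijk -sumr_const.
  by apply: ler_sum => m _; exact: chern_le.
under [X in _ -> _ = 2 + (_ + (_ + X)) -> _]eq_bigl => m do rewrite -andbA.
rewrite -/s; move: (_ * _%:Z) s => t s; lia.
Qed.

End SmoothReflexive.

(** * Polytopes as hulls *)

Local Open Scope classical_set_scope.
Local Open Scope ring_scope.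

Section Dot.
Variables (R : realType) (n : nat).
Implicit Types x y z : 'rV[R]_n.

Lemma dotE x y : dot x y = (x *m y^T) 0 0.
Proof. by rewrite /dot mxE; apply: eq_bigr => i _; rewrite mxE. Qed.

Lemma dotC x y : dot x y = dot y x.
Proof. by apply: eq_bigr => i _; rewrite mulrC. Qed.

Lemma dotDl x y z : dot (x + y) z = dot x z + dot y z.
Proof. by rewrite !dotE mulmxDl mxE. Qed.

Lemma dotZl (t : R) x y : dot (t *: x) y = t * dot x y.
Proof. by rewrite !dotE -scalemxAl mxE. Qed.

Lemma dotDr x y z : dot x (y + z) = dot x y + dot x z.
Proof. by rewrite dotC dotDl !(dotC x). Qed.

Lemma dotZr (t : R) x y : dot x (t *: y) = t * dot x y.
Proof. by rewrite dotC dotZl dotC. Qed.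

Lemma dotNr x y : dot x (- y) = - dot x y.
Proof. by rewrite -scaleN1r dotZr mulN1r. Qed.

Lemma dotBr x y z : dot x (y - z) = dot x y - dot x z.
Proof. by rewrite dotDr dotNr. Qed.

Lemma dot0r x : dot x 0 = 0.
Proof. by rewrite -(scale0r 0) dotZr mul0r. Qed.

Lemma dot_sumr (I : Type) (r : seq I) (P : pred I) x (F : I -> 'rV[R]_n) :
  dot x (\sum_(i <- r | P i) F i) = \sum_(i <- r | P i) dot x (F i).
Proof. by apply: (big_morph (dot x)) => [y z|]; rewrite ?dotDr ?dot0r. Qed.

Lemma dot_sqr_gt0 x : x != 0 -> 0 < dot x x.
Proof.
move=> x0; have ge0 : 0 <= dot x x.
  by apply: sumr_ge0 => i _; rewrite -expr2 sqr_ge0.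
rewrite lt_def ge0 andbT; apply: contraNneq x0 => dx0.
apply/eqP/rowP => i; rewrite mxE; apply/eqP; rewrite -sqrf_eq0 expr2; apply/eqP.
by apply: (psumr_eq0P _ dx0) => // j _; rewrite -expr2 sqr_ge0.
Qed.

Lemma exists_small (s : seq (R * R)) : (forall fg, fg \in s -> fg.1 < 0) ->
  exists2 e : R, 0 < e & forall fg, fg \in s -> fg.1 + e * fg.2 < 0.
Proof.
(* The induction needs the claim for all smaller [e] as well. *)
move=> s0; suff [e0 e00 h] : exists2 e0 : R, 0 < e0 &
    forall e, 0 < e -> e <= e0 -> forall fg, fg \in s -> fg.1 + e * fg.2 < 0.
  by exists e0 => //; apply: h.
elim: s s0 => [|[f g] s IH] s0; first by exists 1.
have [|e1 e10 h1] := IH; first by move=> x xs; apply: s0; rewrite inE xs orbT.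
have /= f0 : f < 0 by apply: (s0 (f, g)); rewrite mem_head.
have g0 : 0 < `|g| + 1 by rewrite ltr_wpDl.
exists (Num.min e1 (- f / (`|g| + 1))).
  by rewrite lt_min e10 divr_gt0 // oppr_gt0.
move=> e e0; rewrite le_min => /andP[ee1 ef] x.
rewrite inE => /orP[/eqP ->|]; last exact: h1.
rewrite /=; move: ef; rewrite ler_pdivlMr // mulrDr mulr1 => ef.
have := ler_norm g; rewrite -(ler_pM2l e0); lra.
Qed.

(** If [a'] vanishes on [z], move it slightly towards [z]: the value becomes [e * dot z z > 0], and
    finitely many strict conditions survive. *)
Lemma exists_generic (G Z : seq 'rV[R]_n) (a : 'rV[R]_n) :
  (forall g, g \in G -> dot a g < 0) -> (forall z, z \in Z -> z != 0) ->
  exists a', (forall g, g \in G -> dot a' g < 0) /\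
             (forall z, z \in Z -> dot a' z != 0).
Proof.
move=> aG; elim: Z => [|z Z IH] Z0; first by exists a.
have [|a' [a'G a'Z]] := IH.
  by move=> y yZ; apply: Z0; rewrite inE yZ orbT.
have z0 : z != 0 by apply: Z0; rewrite mem_head.
have [az|az] := eqVneq (dot a' z) 0; last first.
  by exists a'; split=> // y; rewrite inE => /orP[/eqP ->|/a'Z].
(* A value [dot a' y] stays nonzero if its absolute value exceeds that of the perturbation; this is
   a strict inequality of the form [exists_small] handles. *)
have [|e e0 he] := @exists_small ([seq (dot a' g, dot z g) | g <- G]
    ++ [seq (- `|dot a' y|, `|dot z y|) | y <- Z]).
  move=> fg; rewrite mem_cat => /orP[] /mapP[y yZ ->] /=; first exact: a'G.
  by rewrite oppr_lt0 normr_gt0 a'Z.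
exists (a' + e *: z); split=> y.
  move=> yG; rewrite dotDl dotZl; apply: (he (dot a' y, dot z y)).
  by rewrite mem_cat (map_f (fun g => (dot a' g, dot z g))).
rewrite dotDl dotZl inE => /orP[/eqP ->|yZ].
  by rewrite az add0r mulf_neq0 ?gt_eqF // dot_sqr_gt0.
have : - `|dot a' y| + e * `|dot z y| < 0.
  apply: (he (- `|dot a' y|, `|dot z y|)); rewrite mem_cat.
  by rewrite (map_f (fun y => (- `|dot a' y|, `|dot z y|))) ?orbT.
apply: contraTneq => /eqP; rewrite addr_eq0 => /eqP ->.
by rewrite normrN normrM (gtr0_norm e0) addNr ltxx.
Qed.

End Dot.

Section Hull.
Variables (R : realType) (n : nat).
Implicit Types (s : seq 'rV[R]_n) (a x y v : 'rV[R]_n).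

Lemma hull_nth s (i : 'I_(size s)) : hull s s`_i.
Proof.
exists (fun j => (j == i)%:R); split=> [j|//|]; first exact: ler0n.
  by rewrite (bigD1 i) //= eqxx big1 ?addr0 // => j /negPf ->.
rewrite (bigD1 i) //= eqxx scale1r big1 ?addr0 // => j /negPf ->.
by rewrite scale0r.
Qed.

Lemma hull_convex s x y t : hull s x -> hull s y -> 0 <= t <= 1 ->
  hull s (x + t *: (y - x)).
Proof.
move=> [w [w0 w1 ->]] [w' [w'0 w'1 ->]] /andP[t0 t1].
exists (fun i => (1 - t) * w i + t * w' i); split.
- by move=> i; rewrite addr_ge0 // mulr_ge0 // subr_ge0.
- by rewrite big_split /= -!mulr_sumr w1 w'1; ring.
- rewrite -sumrB scaler_sumr -big_split /=; apply: eq_bigr => i _.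
  by apply/rowP => k; rewrite !mxE; ring.
Qed.

Lemma dot_hull_le s a b x :
  (forall i : 'I_(size s), dot a s`_i <= b) -> hull s x -> dot a x <= b.
Proof.
move=> hs [w [w0 w1 ->]]; rewrite dot_sumr -[b]mul1r -w1 mulr_suml.
by apply: ler_sum => i _; rewrite dotZr ler_wpM2l.
Qed.

(** The nonnegative terms [w i * (b - dot a s_i)] sum to 0. *)
Lemma hull_face_support s a b (w : 'I_(size s) -> R) :
  (forall i : 'I_(size s), dot a s`_i <= b) -> (forall i, 0 <= w i) ->
  \sum_i w i = 1 -> dot a (\sum_i w i *: s`_i) = b ->
  forall i : 'I_(size s), w i != 0 -> dot a s`_i = b.
Proof.
move=> hs w0 w1 wb i wi.
have h : \sum_i w i * (b - dot a s`_i) = 0.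
  under eq_bigr => j _ do rewrite mulrBr.
  rewrite sumrB -mulr_suml w1 mul1r -[X in X - _]wb dot_sumr.
  by apply/eqP; rewrite subr_eq0; apply/eqP/eq_bigr => j _; rewrite dotZr.
have wb0 j : true -> 0 <= w j * (b - dot a s`_j).
  by move=> _; rewrite mulr_ge0 // subr_ge0.
have /eqP : w i * (b - dot a s`_i) = 0 by exact: (psumr_eq0P wb0 h).
by rewrite mulf_eq0 (negPf wi) /= subr_eq0 => /eqP.
Qed.

Lemma segmentP x y z :
  segment x y z <-> exists2 t, 0 <= t <= 1 & z = x + t *: (y - x).
Proof.
split=> [[w [w0]]|[t /andP[t0 t1] ->]].
  rewrite !big_ord_recl !big_ord0 /= !addr0.
  set w1 := w _; set w2 := w _ => w12 ->.
  have -> : w1 = 1 - w2 by rewrite -w12 addrK.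
  exists w2; last by apply/rowP => k; rewrite !mxE; ring.
  by rewrite w0 -w12 lerDr w0.
apply: hull_convex; last by rewrite t0.
  exact: (@hull_nth [:: x; y] ord0).
exact: (@hull_nth [:: x; y] (lift ord0 ord0)).
Qed.

Lemma strict_max_vertex s a x : hull s x ->
  (forall i : 'I_(size s), s`_i != x -> dot a s`_i < dot a x) ->
  vertices (hull s) x.
Proof.
move=> hx hs; have hs' (i : 'I_(size s)) : dot a s`_i <= dot a x.
  by case: (eqVneq s`_i x) => [->//|/hs/ltW].
exists a, (dot a x); split; first by move=> y; apply: dot_hull_le.
apply/seteqP; split=> [y ->//|y [[w [w0 w1 ->]] ya]] /=.
have sup := hull_face_support hs' w0 w1 ya.
rewrite -[RHS]scale1r -w1 scaler_suml; apply: eq_bigr => i _.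
have [->|/sup ai] := eqVneq (w i) 0; first by rewrite !scale0r.
by case: (eqVneq s`_i x) => [->//|/hs]; rewrite ai ltxx.
Qed.

(** A lexicographic maximum, first for [m] and then for [d], is the strict maximum of [m + e *: d]
    for small [e]. *)
Lemma face_max_vertex s m d x : hull s x ->
  (forall i : 'I_(size s), dot m s`_i <= dot m x) ->
  (forall i : 'I_(size s), dot m s`_i = dot m x -> s`_i != x ->
     dot d s`_i < dot d x) ->
  vertices (hull s) x.
Proof.
move=> hx hm hd.
have [|e e0 he] := @exists_small R
    [seq (dot m (y - x), dot d (y - x)) | y <- s & dot m y < dot m x].
  move=> fg /mapP[y]; rewrite mem_filter => /andP[? _] -> /=.
  by rewrite dotBr subr_lt0.
apply: (@strict_max_vertex s (m + e *: d)) => // i six.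
rewrite -subr_lt0 -dotBr dotDl dotZl.
have [lt|ge] := ltP (dot m s`_i) (dot m x).
  apply: (he (dot m (s`_i - x), dot d (s`_i - x))).
  apply/mapP; exists s`_i => //.
  by rewrite mem_filter lt mem_nth.
have E : dot m s`_i = dot m x by apply/eqP; rewrite eq_le hm ge.
by rewrite !dotBr E subrr add0r pmulr_rlt0 // subr_lt0 hd.
Qed.

Lemma vertices_sub_hull s x : vertices (hull s) x -> x \in s.
Proof.
case=> a [b [hb E]]; have [hx ax] : hull s x /\ dot a x = b.
  by have : [set x] x := erefl; rewrite E.
case: hx => w [w0 w1 wx].
have hs (i : 'I_(size s)) : dot a s`_i <= b by apply: hb; apply: hull_nth.
have [i wi] : exists i, w i != 0.
  apply/existsP; rewrite -[X in is_true X]negbK negb_exists.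
  apply/negP => /forallP w00; have /eqP := w1.
  rewrite big1 ?(eq_sym 0) ?oner_eq0 //.
  by move=> i _; apply/eqP; have := w00 i; rewrite negbK.
rewrite wx in ax; have ai := hull_face_support hs w0 w1 ax wi.
have -> : x = s`_i; last exact: mem_nth.
have : [set y | hull s y /\ dot a y = b] s`_i by split=> //; exact: hull_nth.
by rewrite -E.
Qed.

(* One pivot of the simplex method at the vertex [v], for the objective [b]. The
   generic functional [a] maximised at [v] makes the ratio test pick one ray. *)
Lemma improving_edge s v b x : vertices (hull s) v -> hull s x ->
  dot b v < dot b x ->
  exists w, [/\ vertices (hull s) w, is_face (hull s) (segment v w)
    & dot b v < dot b w].
Proof.
move=> [a0 [b0 [hb0 E0]]] hx bx.
have [hv a0v] : hull s v /\ dot a0 v = b0.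
  by have : [set v] v := erefl; rewrite E0.
pose g (i : 'I_(size s)) := s`_i - v.
have a0g i : g i != 0 -> dot a0 (g i) < 0.
  move=> gi; rewrite dotBr subr_lt0 a0v lt_def eq_sym hb0 ?andbT;
    last exact: hull_nth.
  apply: contraNneq gi => ai; rewrite subr_eq0; apply/eqP.
  have : [set y | hull s y /\ dot a0 y = b0] s`_i.
    by split=> //; apply: hull_nth.
  by rewrite -E0.
(* If [a] is nonzero on every nonzero [z i j], equal ratios [tau] force [g i] and [g j] to be
   proportional. *)
pose z i j := dot b (g j) *: g i - dot b (g i) *: g j.
have [||a [aG aZ]] := @exists_generic R n [seq y <- codom g | y != 0]
    [seq y <- [seq z i j | i <- enum 'I_(size s), j <- enum 'I_(size s)]
       | y != 0] a0.
- move=> y; rewrite mem_filter => /andP[y0 /codomP[i yi]].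
  by rewrite yi a0g // -yi.
- by move=> y; rewrite mem_filter => /andP[].
have {aG} ag i : g i != 0 -> dot a (g i) < 0.
  by move=> gi; apply: aG; rewrite mem_filter gi codom_f.
have {aZ} az i j : dot a (z i j) = 0 -> z i j = 0.
  move=> /eqP; apply: contraTeq => zij; apply: aZ; rewrite mem_filter zij.
  by apply/allpairsP; exists (i, j); rewrite /= !mem_enum.
have [i0 bi0] : exists i, 0 < dot b (g i).
  apply: contrapT => /forallNP nb; move: bx; apply/negP; rewrite -leNgt.
  apply: dot_hull_le hx => i; have /negP := nb i.
  by rewrite -leNgt dotBr subr_le0.
pose K := [pred i | 0 < dot b (g i)].
pose tau i := - dot a (g i) / dot b (g i).
have [k1 Kk1 k1min] := @arg_minP _ _ _ i0 K tau bi0.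
(* Among the generators with the least ratio, all on one ray, take the farthest: it is the other end
   of the edge. *)
have [k /andP[Kk /eqP tk] kmax] := @arg_maxP _ _ _ k1
  [pred i | K i && (tau i == tau k1)] (fun i => dot b (g i))
  (introT andP (conj Kk1 (eqxx _))).
rewrite inE in Kk.
have g_neq0 i : 0 < dot b (g i) -> g i != 0.
  by apply: contraTneq => ->; rewrite dot0r ltxx.
have ag_tau i : 0 < dot b (g i) -> dot a (g i) = - (tau i * dot b (g i)).
  by move=> bi; rewrite /tau mulNr mulNr opprK divfK // gt_eqF.
have tau0 : 0 < tau k by rewrite divr_gt0 // oppr_gt0 ag // g_neq0.
(* Tilting [a] towards [b] until the first ties with [v] occur gives the functional supporting the
   edge. *)
pose m := a + tau k *: b.
pose rho i := dot b (g i) / dot b (g k).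
have mg i : dot m (g i) <= 0 /\
    (dot m (g i) = 0 -> 0 <= rho i <= 1 /\ g i = rho i *: g k).
  rewrite /m dotDl dotZl; have [bi|bi] := ltP 0 (dot b (g i)).
    rewrite ag_tau // addrC -mulrBl.
    have ti : tau k <= tau i by rewrite tk k1min.
    split; first by rewrite mulr_le0_ge0 ?subr_le0 // ltW.
    move/eqP; rewrite mulf_eq0 (gt_eqF bi) orbF subr_eq0 => /eqP tki.
    have bik : dot b (g i) <= dot b (g k).
      by apply: kmax; rewrite inE /= bi -tk tki eqxx.
    split.
      by rewrite /rho divr_ge0 ?(ltW bi) ?(ltW Kk) //= ler_pdivrMr // mul1r.
    have : z i k = 0.
      by apply: az; rewrite dotBr !dotZr !ag_tau // tki; ring.
    move/eqP; rewrite subr_eq0 => /eqP zik.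
    by rewrite /rho mulrC -scalerA -zik scalerA mulVf ?scale1r // gt_eqF.
  have bt : tau k * dot b (g i) <= 0 by rewrite mulr_ge0_le0 // ltW.
  have [gi|gi] := eqVneq (g i) 0.
    by rewrite /rho gi !dot0r mulr0 addr0 mul0r scale0r lexx ler01.
  have lt0 : dot a (g i) + tau k * dot b (g i) < 0.
    by rewrite -(addr0 0) ltr_leD // ag.
  by split; [exact: ltW | move/eqP; rewrite lt_eqF].
have mk : dot m (g k) = 0 by rewrite /m dotDl dotZl ag_tau // addNr.
have skE : s`_k = v + g k by rewrite /g addrC subrK.
have ms (i : 'I_(size s)) : dot m s`_i <= dot m v.
  by rewrite -subr_le0 -dotBr (mg i).1.
exists s`_k; split; last by rewrite -subr_gt0 -dotBr.
  have mkv : dot m s`_k = dot m v by apply/eqP; rewrite -subr_eq0 -dotBr mk.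
  apply: (@face_max_vertex s m b); first exact: hull_nth.
    by move=> i; rewrite mkv.
  move=> i; rewrite mkv => mi ik.
  have [|/andP[_ r1] gik] := (mg i).2; first by rewrite dotBr mi subrr.
  have r1' : rho i < 1.
    rewrite lt_neqAle r1 andbT; apply: contraNneq ik => ri.
    by rewrite skE -[s`_i](subrK v) -/(g i) gik ri scale1r addrC.
  rewrite -(ltrD2r (- dot b v)) -!dotBr -/(g i) -/(g k) gik dotZr.
  by rewrite gtr_pMl.
exists m, (dot m v); split; first by move=> y; apply: dot_hull_le.
apply/seteqP; split=> [y /segmentP[t t01 ->]|y [[w [w0 w1 yE]] my]] /=.
  split; first by apply: hull_convex => //; apply: hull_nth.
  by rewrite dotDr dotZr mk mulr0 addr0.
rewrite yE in my; have sup := hull_face_support ms w0 w1 my.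
have wr i : 0 <= w i * rho i <= w i /\ w i *: g i = (w i * rho i) *: g k.
  have [->|/sup mi] := eqVneq (w i) 0; first by rewrite mul0r !scale0r lexx.
  have [|/andP[r0 r1] gik] := (mg i).2; first by rewrite dotBr mi subrr.
  rewrite mulr_ge0 //= ler_piMr // -scalerA -gik; split=> //.
apply/segmentP; exists (\sum_i w i * rho i).
  rewrite sumr_ge0 /=; last by move=> i _; case: (wr i) => /andP[].
  by rewrite -w1; apply: ler_sum => i _; case: (wr i) => /andP[].
rewrite -/(g k) scaler_suml yE.
have -> : \sum_i (w i * rho i) *: g k = \sum_i w i *: g i.
  by apply: eq_bigr => i _; rewrite (wr i).2.
rewrite /g; under [X in _ + X]eq_bigr => i _ do rewrite scalerBr.
by rewrite sumrB -scaler_suml w1 scale1r addrC subrK.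
Qed.

End Hull.

(** * Lattice polytopes *)

Section Content.
Variable n : nat.
Implicit Types v p q : 'rV[int]_n.

Lemma content_dvd v i : (content v %| absz (v 0%R i))%N.
Proof. by rewrite /content (bigD1 i) //= dvdn_gcdl. Qed.

Lemma contentN v : content (- v) = content v.
Proof. by apply: eq_bigr => i _; rewrite mxE abszN. Qed.

Lemma content_gt0 v : v != 0 -> (0 < content v)%N.
Proof.
move=> v0; rewrite lt0n; apply: contraNneq v0 => c0; apply/eqP/rowP => i.
have := content_dvd v i; rewrite c0 dvd0n absz_eq0 mxE => /eqP //.
Qed.

Lemma content_edge_dir p q : (content (q - p))%:Z *: edge_dir p q = q - p.
Proof.
apply/rowP => i; rewrite [LHS]mxE [edge_dir _ _ _ _]mxE mulrC divzK //.
exact: content_dvd.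
Qed.

Lemma edge_dirC p q : p <> q -> edge_dir q p = - edge_dir p q.
Proof.
move=> pq; have c0 : (content (q - p))%:Z != 0.
  by rewrite eqz_nat -lt0n content_gt0 // subr_eq0; apply/eqP => /esym.
apply/rowP => i; apply: (mulfI c0).
have E : (content (q - p))%:Z *: edge_dir q p
    = (content (q - p))%:Z *: - edge_dir p q.
  by rewrite scalerN content_edge_dir -contentN opprB content_edge_dir.
by move/rowP/(_ i): E; rewrite [LHS]mxE [RHS]mxE.
Qed.

End Content.

Section Lattice.
Variables (R : realType) (n : nat).
Implicit Types (D : set 'rV[R]_n) (p q : 'rV[int]_n).

Lemma zvec_inj : injective (@zvec R n).
Proof.
move=> p q /rowP E; apply/rowP => i; have := E i.
by rewrite !mxE => /intr_inj.
Qed.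

Lemma dot_zvec p q : dot (zvec R p) (zvec R q) = ((p *m q^T) 0 0)%:~R.
Proof.
by rewrite dotE /zvec map_trmx -map_mxM mxE.
Qed.

Lemma segmentC (x y : 'rV[R]_n) : segment x y = segment y x.
Proof.
suff sub (u v : 'rV[R]_n) : segment u v `<=` segment v u by apply/seteqP.
move=> _ /segmentP[t /andP[t0 t1] ->]; apply/segmentP; exists (1 - t).
  by rewrite subr_ge0 t1 lerBlDr lerDl.
by apply/rowP => k; rewrite !mxE; ring.
Qed.

(** Apply [face_max_vertex] to the functional of the edge, with [x - y] breaking ties. *)
Lemma segment_face_vertex D (x y : 'rV[R]_n) : is_polytope D -> x != y ->
  is_face D (segment x y) -> vertices D x.
Proof.
move=> [s ->] xy [m [b [hb E]]].
have [hx mx] : hull s x /\ dot m x = b.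
  have : segment x y x.
    by apply/segmentP; exists 0; rewrite ?lexx ?ler01 // scale0r addr0.
  by rewrite E.
apply: (@face_max_vertex _ _ s m (x - y)) => //.
  by move=> i; rewrite mx; apply/hb/hull_nth.
move=> i mi six; have : segment x y s`_i.
  by rewrite E; split; [exact: hull_nth | rewrite mi].
move=> /segmentP[t /andP[t0 _] si]; rewrite si dotDr dotZr gtrDl.
rewrite -[y - x]opprB dotNr mulrN oppr_lt0 mulr_gt0 //; last first.
  by rewrite dot_sqr_gt0 // subr_eq0.
rewrite lt_def t0 andbT; apply: contraNneq six => t00.
by rewrite si t00 scale0r addr0.
Qed.

Lemma is_edgeC D p q : is_edge D p q -> is_edge D q p.
Proof. by move=> [pq]; rewrite segmentC; split=> // /esym. Qed.

Lemma is_edge_vertex D p q : is_polytope D -> is_edge D p q ->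
  vertices D (zvec R p).
Proof.
move=> hD [pq]; apply: segment_face_vertex => //.
by apply/eqP => /zvec_inj.
Qed.

Lemma Zbasis_unitmx (b : 'I_n -> 'rV[int]_n) :
  is_Zbasis b -> \matrix_i b i \in unitmx.
Proof.
move=> hb.
have ex j : exists c : 'rV[int]_n, delta_mx 0 j = \sum_i c 0 i *: b i.
  by have [c []] := hb (delta_mx 0 j); exists c.
have [C hC] := choice ex.
suff /mulmx1_unit[] : \matrix_j C j *m \matrix_i b i = 1%:M by [].
apply/row_matrixP => j; rewrite row_mul rowK row1 [RHS]hC mulmx_sum_row.
by apply: eq_bigr => i _; rewrite rowK.
Qed.

(** A point with negative [i]-th coordinate would yield, by [improving_edge], an edge at [p] along
    which this coordinate decreases; but each edge is a positive multiple of a basis vector. *)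
Lemma tangent_cone D p (q : 'I_n -> 'rV[int]_n) x i :
  is_lattice_polytope D -> vertices D (zvec R p) ->
  (forall r, is_edge D p r <-> exists i, r = q i) ->
  \matrix_i edge_dir p (q i) \in unitmx -> D x ->
  0 <= ((x - zvec R p) *m map_mx intr (invmx (\matrix_i edge_dir p (q i)))) 0 i.
Proof.
move=> [[s ->] lat] vp hq; set A := \matrix_i _ => Au Dx; rewrite leNgt.
apply/negP => x_lt0.
pose b : 'rV[R]_n := - (col i (map_mx intr (invmx A)))^T.
have bE y : dot b y = - (y *m map_mx intr (invmx A)) 0 i.
  rewrite dotC dotNr dotE trmxK !mxE; congr (- _).
  by apply: eq_bigr => k _; rewrite !mxE.
have [|w [vw fw bw]] := @improving_edge _ _ s (zvec R p) b x vp Dx.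
  by rewrite -subr_gt0 -dotBr bE oppr_gt0.
have [w' wE] := lat w vw; subst w.
have [|j w'E] := (hq w').1.
  by split=> // pw'; move: bw; rewrite pw' ltxx.
move: bw; rewrite -subr_gt0 -dotBr bE oppr_gt0 ltNge => /negP; apply.
rewrite /zvec -map_mxB -map_mxM mxE ler0z w'E -content_edge_dir -scalemxAl.
have -> : edge_dir p (q j) = row j A by rewrite rowK.
by rewrite -row_mul mulmxV // row1 !mxE mulr_ge0.
Qed.


Lemma vertices_sub D x : vertices D x -> D x.
Proof.
by move=> [a [b [_ E]]]; have : [set x] x := erefl; rewrite E => -[].
Qed.

Lemma interior0_small_scale D (U : 'rV[R]_n) : interior D 0 ->
  exists2 t : R, 0 < t & D (t *: U).
Proof.
move=> /nbhs_ballP[e /= e0 sub].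
have S0 : 0 < 1 + \sum_j `|U 0 j| by rewrite ltr_pwDl // sumr_ge0.
exists (e / (1 + \sum_j `|U 0 j|)); first exact: divr_gt0.
apply: sub; split=> // i j; rewrite /ball /= !mxE sub0r normrN normrM ord1.
rewrite gtr0_norm ?divr_gt0 // mulrAC ltr_pdivrMr // ltr_pM2l //.
by rewrite (bigD1 j) //= addrCA ltrDl ltr_pwDl // sumr_ge0.
Qed.

(* The facet [u >= - h] through [p] opposite to the edge [i] gives the vertex
   [- u / h] of the dual polytope; it is integral only when [h = 1]. *)
Lemma reflexive_vertex D p (q : 'I_n -> 'rV[int]_n) :
  is_reflexive D -> vertices D (zvec R p) ->
  (forall r, is_edge D p r <-> exists i, r = q i) ->
  \matrix_i edge_dir p (q i) \in unitmx ->
  p = - \sum_i row i (\matrix_i edge_dir p (q i)).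
Proof.
move=> [latD int0 latdual] vp hq; set A := \matrix_i _ => Au.
suff h1 i : (p *m invmx A) 0 i = -1.
  rewrite -{1}[p](mulmxKV Au) mulmx_sum_row -sumrN.
  by apply: eq_bigr => i _; rewrite h1 scaleN1r.
set h := - (p *m invmx A) 0 i; suff : h = 1 by rewrite /h => <-; rewrite opprK.
pose M : 'M[R]_n := map_mx intr (invmx A).
pose U : 'rV[R]_n := (col i M)^T.
have dotU y : dot y U = (y *m M) 0 i.
  by rewrite dotE trmxK !mxE; apply: eq_bigr => k _; rewrite !mxE.
have pU : dot (zvec R p) U = - h%:~R.
  by rewrite dotU /M -map_mxM mxE /h rmorphN opprK.
have rowU j : dot (zvec R (row j A)) U = (i == j)%:R.
  by rewrite dotU /M -map_mxM -row_mul mulmxV // row1 !mxE eqxx rmorph_nat.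
have cone x : D x -> - h%:~R <= dot x U.
  move=> /(tangent_cone i latD vp hq Au).
  by rewrite -dotU dotC dotBr !(dotC U) pU subr_ge0.
have U0 : U != 0.
  apply/eqP => U0; have := rowU i; rewrite U0 dot0r eqxx => /eqP.
  by rewrite eq_sym oner_eq0.
(* A small multiple of [- U] lies in [D], strictly on the negative side of the origin. *)
have h0 : (0 : R) < h%:~R.
  have [t t0 Dt] := interior0_small_scale (- U) int0.
  have := cone _ Dt; rewrite dotC dotZr dotNr mulrN lerN2; apply: lt_le_trans.
  by rewrite mulr_gt0 // dot_sqr_gt0.
pose y : 'rV[R]_n := - (h%:~R^-1) *: U.
have doty x : dot x y = - dot x U / h%:~R by rewrite dotZr mulNr mulrC -mulNr.
(* These [n] points of the facet are linearly independent, and [y] is the only point pairing to 1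
   with all of them; their sum supports the dual at [y] alone. *)
pose c j := if j == i then p else q j.
have edgep j : is_edge D p (q j) by apply/hq; exists j.
have Dc j : D (zvec R (c j)).
  apply: vertices_sub; rewrite /c; case: eqP => // _.
  by apply: is_edge_vertex (is_edgeC (edgep j)); case: latD.
have qjE j : q j = p + (content (q j - p))%:Z *: row j A.
  by rewrite rowK content_edge_dir addrC subrK.
have c_gt0 j : (0 : R) < (content (q j - p))%:~R.
  rewrite ltr0z; apply: content_gt0; rewrite subr_eq0; apply/eqP => qp.
  by case: (edgep j); rewrite qp.
have zqj j z : dot (zvec R (q j)) z = dot (zvec R p) z
    + (content (q j - p))%:~R * dot (zvec R (row j A)) z.
  by rewrite {1}qjE /zvec map_mxD map_mxZ dotC dotDr dotZr !(dotC z).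
have yc j : dot (zvec R (c j)) y = 1.
  rewrite doty /c; case: eqP => [_|/eqP ji].
    by rewrite pU opprK divff // gt_eqF.
  rewrite zqj rowU eq_sym (negPf ji) mulr0 addr0 pU opprK divff // gt_eqF //.
have vy : vertices (dual_polytope D) y.
  exists (\sum_j zvec R (c j)), n%:R; split.
    move=> z zD; rewrite dotC dot_sumr -[n in n%:R]card_ord -sumr_const.
    by apply: ler_sum => j _; rewrite dotC; exact: zD.
  apply/seteqP; split=> [z ->|z [zD zn]] /=.
    split; first by move=> x Dx; rewrite doty ler_pdivrMr // mul1r lerNl cone.
    rewrite dotC dot_sumr -[n in RHS]card_ord -sumr_const.
    by apply: eq_bigr => j _; rewrite dotC yc.
  have z1 j : dot (zvec R (c j)) z = 1.
    have sum0 : \sum_j (1 - dot (zvec R (c j)) z) = 0.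
      rewrite sumrB sumr_const card_ord -zn dotC dot_sumr.
      by apply/eqP; rewrite subr_eq0; apply/eqP/eq_bigr => k _; rewrite dotC.
    have ge0 k : true -> 0 <= 1 - dot (zvec R (c k)) z.
      by rewrite subr_ge0 => _; exact: zD.
    apply/esym/eqP; rewrite -subr_eq0; apply/eqP.
    exact: (psumr_eq0P ge0 sum0).
  apply/eqP; rewrite -subr_eq0; apply/eqP; set d := z - y.
  have cd j : dot (zvec R (c j)) d = 0 by rewrite dotBr z1 yc subrr.
  have pd : dot (zvec R p) d = 0 by have := cd i; rewrite /c eqxx.
  have rd0 j : j != i -> dot (zvec R (row j A)) d = 0.
    move=> ji; have := cd j; rewrite /c (negPf ji) zqj pd add0r => /eqP.
    by rewrite mulf_eq0 gt_eqF //= => /eqP.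
  (* For the row [i], expand [p]: its [i]-th coefficient is [- h], which is nonzero. *)
  have rd j : dot (zvec R (row j A)) d = 0.
    have [->|/rd0//] := eqVneq j i; move: pd.
    rewrite -{1}[p](mulmxKV Au) mulmx_sum_row /zvec map_mx_sum dotC dot_sumr.
    rewrite (bigD1 i) //= big1 ?addr0 => [|k ki]; last first.
      by rewrite map_mxZ dotZr dotC rd0 ?mulr0.
    rewrite map_mxZ dotZr dotC => /eqP; rewrite mulf_eq0 => /orP[|/eqP //].
    by rewrite -[_ 0 i]opprK -/h rmorphN oppr_eq0 gt_eqF.
  have : d *m (map_mx intr A)^T = 0.
    apply/rowP => j; rewrite [RHS]mxE -(rd j) dotC dotE !mxE.
    by apply: eq_bigr => k _; rewrite !mxE.
  move=> /(congr1 (mulmx^~ (M^T))); rewrite -mulmxA -trmx_mul /M -map_mxM.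
  by rewrite mulVmx // map_mx1 trmx1 mulmx1 mul0mx.
have [w wE] := latdual.2 y vy.
(* Pairing the integral vertex [y] with row [i] gives the integer [- 1 / h]. *)
have := doty (zvec R (row i A)); rewrite rowU eqxx wE dot_zvec.
set m := (_ *m _) 0 0 => mE.
have {mE} : (m * h)%:~R = (-1)%:~R :> R.
  by rewrite rmorphM /= mE mulNr mul1r mulNr mulVf ?gt_eqF // rmorphN.
move=> /intr_inj mh; move: h0; rewrite ltr0z => h0.
have : absz (m * h) = 1%N by rewrite mh.
by rewrite abszM => /eqP; rewrite muln_eq1 => /andP[_ /eqP]; lia.
Qed.

End Lattice.

(** * The bounds for smooth reflexive polytopes *)

(** The constant of the theorem is [(x + 1) * y] times [x * (x + 1) / 2], a factor exceeding 1. *)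
Lemma line_chern_bounds (F : realFieldType) (x y c : F) : 3 <= x -> 0 < y ->
  - 2 - (x - 3) * ((x + 1) * y) <= c -> c <= (x + 1) * y ->
  (3 - x) * y * (x * (x + 1) ^+ 2 / 2) - 2 <= c
  /\ c < y * (x * (x + 1) ^+ 2 / 2).
Proof.
move=> x3 y0 lo hi.
have -> : x * (x + 1) ^+ 2 / 2 = (x + 1) * (x * (x + 1) / 2) by ring.
have : 1 < x * (x + 1) / 2 by nra.
move: (x * _ / 2) => B B1.
have xy0 : 0 < (x + 1) * y by apply: mulr_gt0; lra.
have yB : (x + 1) * y < y * ((x + 1) * B).
  have : 0 < ((x + 1) * y) * (B - 1) by apply: mulr_gt0; lra.
  by lra.
split; last exact: le_lt_trans yB.
have : 0 <= (x - 3) * (y * ((x + 1) * B) - (x + 1) * y) by apply: mulr_ge0; lra.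
by lra.
Qed.

Theorem corollary6p4 (R : realType) (n : nat) (hn : (3 <= n)%N)
    (D : set 'rV[R]_n) (hsm : is_smooth D) (hrefl : is_reflexive D)
    (p q r : 'rV[int]_n)
    (he : is_edge D p q) (hf : is_edge D p r) (hqr : q <> r)
    (c : int) (hc : is_line_chern D p q r c) :
  (3 - n%:R) * (num_vertices D)%:R * (n%:R * (n%:R + 1) ^+ 2 / 2) - 2
    <= c%:~R :> R
  /\ c%:~R < (num_vertices D)%:R * (n%:R * (n%:R + 1) ^+ 2 / 2) :> R.
Proof.
have [latD _ smD] := hsm; have [polyD lat] := latD.
have finV : finite_set (vertices D).
  have [s DE] := polyD.
  apply: (@sub_finite_set _ _ [set` s]); last exact: finite_seq.
  by rewrite DE => x /vertices_sub_hull.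
pose T : finType := fset_set (vertices D).
have valV (t : T) : vertices D (val t).
  by have := valP t; rewrite in_fset_set // inE.
have exT x : vertices D x -> exists t : T, val t = x.
  move=> vx; have xT : (x \in fset_set (vertices D))%fset.
    by rewrite in_fset_set // inE.
  by exists [` xT]%fset.
have [pos posE] := choice (fun t => lat _ (valV t)).
have pos_inj : injective pos by move=> t u tu; apply: val_inj; rewrite !posE tu.
have vpos t : vertices D (zvec R (pos t)) by rewrite -posE.
have exnb t : exists nb : 'I_n -> T,
    (forall r, is_edge D (pos t) r <-> exists i, r = pos (nb i)) /\
    \matrix_i edge_dir (pos t) (pos (nb i)) \in unitmx.
  have [q' [_ hq' bas]] := smD _ (vpos t).
  have /choice[nb nbE] i : exists u, pos u = q' i.
    have /is_edgeC/(is_edge_vertex polyD)/exT[u uE] : is_edge D (pos t) (q' i).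
      by apply/hq'; exists i.
    by exists u; apply: (@zvec_inj R); rewrite -posE.
  exists nb; split=> [u|].
    by rewrite hq'; split=> -[i ->]; exists i; rewrite nbE.
  by under eq_mx do rewrite nbE; exact: (Zbasis_unitmx bas).
have [nb hnb] := choice exnb.
pose A t := \matrix_i edge_dir (pos t) (pos (nb t i)).
have A_unit t : A t \in unitmx by case: (hnb t).
have rowA t i : row i (A t) = edge_dir (pos t) (pos (nb t i)) by rewrite rowK.
have edge_nb t i : is_edge D (pos t) (pos (nb t i)).
  by apply/(hnb t).1; exists i.
(* Each vertex is a neighbour of its neighbours, which gives the index of the reversed edge. *)
have exbk (ti : T * 'I_n) : exists k, pos ti.1 = pos (nb (nb ti.1 ti.2) k).
  by apply/(hnb _).1; apply: is_edgeC.
have [bk2 hbk2] := choice exbk; pose bk t i := bk2 (t, i).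
pose len t i := (content (pos (nb t i) - pos t))%:Z.
have coord_ge0 v w i : 0 <= ((pos w - pos v) *m invmx (A v)) 0 i.
  have Dw : D (zvec R (pos w)) by apply: vertices_sub.
  have := tangent_cone i latD (vpos v) (hnb v).1 (A_unit v) Dw.
  by rewrite /zvec -map_mxB -map_mxM mxE ler0z.
have len_gt0 v i : 0 < len v i.
  apply: content_gt0; rewrite subr_eq0; apply/eqP => E.
  by case: (edge_nb v i); rewrite E.
have pos_nb v i : pos (nb v i) = pos v + len v i *: row i (A v).
  by rewrite rowA content_edge_dir addrC subrK.
have row_bk v i : row (bk v i) (A (nb v i)) = - row i (A v).
  rewrite !rowA -(hbk2 (v, i)) /=; apply: edge_dirC; exact: (edge_nb v i).1.
have pos_sum v : pos v = - \sum_i row i (A v).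
  exact: reflexive_vertex hrefl (vpos v) (hnb v).1 (A_unit v).
have [v vE] := exT _ (is_edge_vertex polyD he).
have {vE} pv : p = pos v by apply: (@zvec_inj R); rewrite -posE.
subst p.
have [i qE] := ((hnb v).1 q).1 he; have [j rE] := ((hnb v).1 r).1 hf.
have ji : j != i by apply: contra_notN hqr => /eqP ij; rewrite qE rE ij.
subst q r; case: hc => F [s [_ _ [hs _] _ cE]].
have [k sE] := ((hnb (nb v i)).1 s).1 hs; subst s.
(* The end of nabla_e(f) is the [k]-th neighbour of [q], so [chern_unique] applies with
   [j' := k]. *)
have {cE} -> : c = chern A nb bk v i j.
  apply: (chern_unique A_unit row_bk (j' := k) ji).
  by rewrite !rowA -cE subKr.
have := chern_le pos_inj A_unit coord_ge0 len_gt0 pos_nb row_bk pos_sum v i j.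
have := chern_ge pos_inj A_unit coord_ge0 len_gt0 pos_nb row_bk pos_sum v ji hn.
have -> : #|T| = num_vertices D by rewrite /num_vertices cardfE.
have N_gt0 : (0 < num_vertices D)%N.
  by rewrite /num_vertices cardfE; apply/card_gt0P; exists v.
move: (chern _ _ _ _ _ _) (num_vertices D) N_gt0 => m N N_gt0.
rewrite -!(ler_int R).
rewrite rmorphB rmorphM rmorphN /= -!pmulrn !natrM -natr1 natrB //=.
have n3 : 3 <= n%:R :> R by rewrite ler_nat.
have N0 : 0 < N%:R :> R by rewrite ltr0n.
exact: line_chern_bounds.
Qed.
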